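(* Let $N\ge 1$, let $\mathcal S$ be a nonempty set system on $[N]$, and let $\mathcal P_{\mathcal S}$ be its corresponding projection system. Then $\mathrm{QDisc}(\mathcal P_{\mathcal S})=0$ if and only if $\mathrm{Disc}(\mathcal S)=0$.
   Context: $[N]=\{1,\dots,N\}$. A set system on $[N]$ is a subset $\mathcal S\subseteq 2^{[N]}$. A coloring of $[N]$ is a function $\chi:[N]\to\{1,-1\}$; put $\chi(S)=\sum_{s\in S}\chi(s)$. The (combinatorial) discrepancy is $\mathrm{Disc}(\mathcal S)=\min_{\chi\ \text{coloring}}\max_{S\in\mathcal S}|\chi(S)|$. $\mathcal M_N(\mathbb C)$ is the set of $N\times N$ complex matrices. A projection system in $\mathbb C^N$ is a finite set $\mathcal P$ of orthogonal projections, i.e. matrices $P\in\mathcal M_N(\mathbb C)$ with $P^2=P=P^*$. A quantum coloring is a Hermitian matrix $\chi\in\mathcal M_N(\mathbb C)$ all of whose eigenvalues lie in $\{1,-1\}$. With $[A,B]=AB-BA$ and $\mathrm{tr}^2(X)=(\mathrm{tr}\,X)^2$, $$\mathrm{QDisc}(\mathcal P)=\min_{\chi\ \text{quantum coloring}}\ \max_{P\in\mathcal P}\left[\mathrm{tr}^2(\chi P)+\mathrm{tr}(\chi[\chi,P]P)\right]^{1/2}$$ (the expression in brackets is always real and non-negative). For $S\subseteq[N]$, $P_S$ is the diagonal $N\times N$ matrix whose $i$-th diagonal entry is $1$ if $i\in S$ and $0$ otherwise; $\mathcal P_{\mathcal S}=\{P_S:S\in\mathcal S\}$. *)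

(* Defs.v *)
From HB Require Import structures.
From mathcomp Require Import all_boot all_order all_algebra.
From mathcomp Require Import finmap complex spectral sesquilinear.
From mathcomp Require Import classical_sets reals.

Set Implicit Arguments.
Unset Strict Implicit.
Unset Printing Implicit Defensive.

Import Order.TTheory GRing.Theory Num.Theory.
Local Open Scope ring_scope.
Local Open Scope sesquilinear_scope.

Section Combinatorial.
Variable N : nat.

(* [true] encodes the color -1 and [false] the color 1. *)
Definition coloring := {ffun 'I_N -> bool}.

Definition coloring_sum (chi : coloring) (A : {set 'I_N}) : int :=
  \sum_(s in A) (-1) ^+ chi s.

Definition coloring_disc (F : {set {set 'I_N}}) (chi : coloring) : nat :=
  (\max_(A in F) `|coloring_sum chi A|)%N.

Definition Disc (F : {set {set 'I_N}}) : nat :=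
  coloring_disc F
    [arg min_(chi < ([ffun=> false] : coloring)) coloring_disc F chi]%N.

End Combinatorial.

Section Quantum.
Variables (R : realType) (N : nat).
Implicit Types (P chi : 'M[R[i]]_N).

Definition orthogonal_projection P : Prop := P *m P = P /\ P^t* = P.

Record projection_system := ProjectionSystem {
  projections :> {fset 'M[R[i]]_N};
  projectionsP : forall P, P \in projections -> orthogonal_projection P
}.

Definition quantum_coloring chi : Prop :=
  chi \is hermsymmx /\ forall a : R[i], eigenvalue chi a -> a = 1 \/ a = -1.

Definition mxcomm (A B : 'M[R[i]]_N) : 'M[R[i]]_N := A *m B - B *m A.

Definition qdisc_expr chi P : R[i] :=
  (\tr (chi *m P)) ^+ 2 + \tr (chi *m mxcomm chi P *m P).

(* In the order of [R[i]], [0 <= z] says that [z] is real and nonnegative, so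
   nothing is lost by taking the real part in [quantum_coloring_disc]. *)
Lemma qdisc_expr_ge0 chi P :
  quantum_coloring chi -> orthogonal_projection P -> 0 <= qdisc_expr chi P.
Proof.
move=> [/is_hermitianmxP]; rewrite expr0 scale1r => chiH _ [PP PH].
have trC (A : 'M[R[i]]_N) : \tr (A^t*) = (\tr A)^*.
  by rewrite trace_map_mx mxtrace_tr.
have adjM (A B : 'M[R[i]]_N) : (A *m B)^t* = B^t* *m A^t*.
  by rewrite trmx_mul map_mxM.
have adjB (A B : 'M[R[i]]_N) : (A - B)^t* = A^t* - B^t*.
  by rewrite linearB /= map_mxB.
apply: addr_ge0.
  apply: real_exprn_even_ge0 => //.
  by apply/CrealP; rewrite -trC adjM -chiH PH mxtrace_mulC.
have K : 0 <= \tr ((mxcomm chi P) *m (mxcomm chi P)^t*).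
  rewrite /mxtrace sumr_ge0 // => i _; rewrite mxE sumr_ge0 // => j _.
  by rewrite !mxE mul_conjC_ge0.
rewrite -(pmulrn_lge0 _ (ltn0Sn 1)); move: K; congr (0 <= _).
rewrite /mxcomm adjB !adjM -chiH PH !(mulmxBl, mulmxBr) !linearB /= mulr2n.
rewrite -!mulmxA PP.
have -> : \tr (chi *m (P *m (P *m chi))) = \tr (chi *m (chi *m P)).
  by rewrite (mulmxA P) PP mxtrace_mulC -mulmxA mxtrace_mulC -mulmxA.
have -> : \tr (P *m (chi *m (P *m chi))) = \tr (chi *m (P *m (chi *m P))).
  by rewrite mxtrace_mulC -!mulmxA.
have -> : \tr (P *m (chi *m (chi *m P))) = \tr (chi *m (chi *m P)).
  by rewrite mxtrace_mulC -!mulmxA PP.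
by rewrite opprK [- _ + _]addrC.
Qed.

Definition quantum_coloring_disc (sys : projection_system) chi : R :=
  \big[Num.max/0]_(P <- projections sys)
     Num.sqrt (complex.Re (qdisc_expr chi P)).

(* For [0 < N] the infimum is a minimum: the quantum colorings form a nonempty
   compact set, on which [quantum_coloring_disc sys] is continuous. *)
Definition QDisc (sys : projection_system) : R :=
  inf [set quantum_coloring_disc sys chi | chi in quantum_coloring]%classic.

Definition set_projection (A : {set 'I_N}) : 'M[R[i]]_N :=
  \matrix_(i, j) ((i == j) && (i \in A))%:R.

Lemma set_projectionP A : orthogonal_projection (set_projection A).
Proof.
split; apply/matrixP => i j; rewrite !mxE.
  rewrite (bigD1 i) //= big1 => [|k /negPf ki]; rewrite !mxE.
    by rewrite addr0 eqxx -natrM mulnb; case: eqP => [->|]; rewrite ?andbb ?andbF.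
  by rewrite eq_sym ki mul0r.
by rewrite conjC_nat eq_sym; case: eqP => // ->.
Qed.

Lemma set_projectionsP (F : {set {set 'I_N}}) P :
  P \in [fset set_projection A | A in F]%fset -> orthogonal_projection P.
Proof. by case/imfsetP => A _ ->; apply: set_projectionP. Qed.

Definition set_projection_system (F : {set {set 'I_N}}) : projection_system :=
  ProjectionSystem (@set_projectionsP F).

End Quantum.

(* Main.v *)
(* For a quantum coloring [chi], Hermitian with [chi^2 = 1], the expression in
   QDisc at [P_A] is [(sum_(i in A) chi_ii)^2 + b(A)], where
   [b(A) = sum_(i in A, j notin A) |chi_ij|^2].  A coloring gives a diagonal
   quantum coloring with [b = 0], which settles one direction.
   Conversely, if QDisc is 0 there are quantum colorings for which all these
   values are tiny (working with these avoids showing that the infimum is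
   attained).  Then [b(K)] is tiny for every atom [K] of the Boolean algebra
   generated by F, so the compression of [chi] to [K] is nearly an involution,
   its eigenvalues are close to signs, and its trace is close to the sum of a
   coloring of [K].  Gluing these colorings over the atoms gives, on each member
   of F, an integer of absolute value less than 1. *)
Require Import Defs.
From mathcomp Require Import all_boot all_order all_algebra reals.
From mathcomp Require Import finmap complex spectral sesquilinear ring zify.
From mathcomp Require classical_sets.

Set Implicit Arguments.
Unset Strict Implicit.
Unset Printing Implicit Defensive.

Import Order.TTheory GRing.Theory Num.Theory.
Local Open Scope ring_scope.
Local Open Scope sesquilinear_scope.

(** * Hermitian matrices and sums of signs *)

Section Spectral.
Variables (C : numClosedFieldType) (n : nat).
Implicit Types (A M X : 'M[C]_n).

Lemma hermsymmxP A : reflect (A^t* = A) (A \is hermsymmx).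
Proof.
by apply: (iffP (is_hermitianmxP _ _ _)); rewrite expr0 scale1r => /esym.
Qed.

Lemma hermsymmx_diag M : M \is hermsymmx ->
  spectralmx M *m M *m (spectralmx M)^t* = diag_mx (spectral_diag M).
Proof.
move=> /hermitian_normalmx/orthomx_spectralP {2}->.
rewrite -invmx_unitary ?spectral_unitarymx // !mulmxA mulmxV ?spectral_unit//.
by rewrite mul1mx mulmxK ?spectral_unit.
Qed.

Lemma mxtrace_unitary_conj (U M : 'M[C]_n) : U \is unitarymx ->
  \tr (U *m M *m U^t*) = \tr M.
Proof.
move=> Uu; rewrite -invmx_unitary // mxtrace_mulC mulmxA mulVmx ?mul1mx //.
exact: unitarymx_unit.
Qed.

Lemma adjmxM m p q (A : 'M[C]_(m, p)) (B : 'M_(p, q)) :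
  (A *m B)^t* = B^t* *m A^t*.
Proof. by rewrite trmx_mul map_mxM. Qed.

Lemma mulmx_adj_diag_ge0 X l : 0 <= (X *m X^t*) l l.
Proof. by rewrite mxE sumr_ge0 // => j _; rewrite !mxE mul_conjC_ge0. Qed.

(** Factor [1 - d^2 = (1 - |d|)(1 + |d|)]: the first factor is the distance from [d] to its sign,
    the second is at least 1. *)
Lemma dist_sign_le (d : C) : d \is Num.real -> d ^+ 2 <= 1 ->
  `|d - (-1) ^+ (d < 0)%R| <= 1 - d ^+ 2.
Proof.
move=> dr; rewrite -real_normK // expr_le1 // => d1.
have [d0|d0] := real_ltP dr (real0 _).
  move: d1; rewrite ltr0_norm // => d1; rewrite expr1 opprK ger0_norm; last first.
    by rewrite -[1]opprK subr_ge0 lerNl.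
  have -> : 1 - (- d) ^+ 2 = (d + 1) * (1 + (- d)) by ring.
  rewrite ler_peMr //; first by rewrite -[1]opprK subr_ge0 lerNl.
  by rewrite lerDl oppr_ge0 ltW.
move: d1; rewrite ger0_norm // => d1; rewrite expr0 ler0_norm ?subr_le0 // opprB.
have -> : 1 - d ^+ 2 = (1 - d) * (1 + d) by ring.
by rewrite ler_peMr ?subr_ge0 ?lerDl.
Qed.

Lemma sum_sign (I : finType) (b : pred I) :
  \sum_i (-1) ^+ b i = #|I|%:R - (#|b|.*2)%:R :> C.
Proof.
under eq_bigr => i _ do rewrite signrE.
rewrite sumrB sumr_const -muln2 natrM -[#|b|]sum1_card natr_sum mulr_suml.
rewrite [in RHS]big_mkcond; congr (_ - _); apply: eq_bigr => i _ /=.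
by rewrite unfold_in -muln2 natrM; case: (b i); rewrite ?mul0r.
Qed.

(* [1 - M^2] is positive semidefinite, so every eigenvalue [d] of [M] lies in
   [[-1, 1]] and its distance to the nearest sign is at most [1 - d^2]; these
   bounds add up to the trace of [1 - M^2]. *)
Lemma mxtrace_near_sign M X :
  M \is hermsymmx -> M *m M + X *m X^t* = 1%:M ->
  exists2 p, (p <= n)%N & `|\tr M - (n%:R - p.*2%:R)| <= \tr (X *m X^t*).
Proof.
move=> Mh MX; set U := spectralmx M; set d := spectral_diag M.
have Uu : U \is unitarymx by apply: spectral_unitarymx.
have D : U *m M *m U^t* = diag_mx d := hermsymmx_diag Mh.
have dr l : d 0 l \is Num.real.
  by have /mxOverP := hermitian_spectral_diag_real Mh; apply.
have D2 : U *m (M *m M) *m U^t* = diag_mx (\row_l d 0 l ^+ 2).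
  have -> : U *m (M *m M) *m U^t* = (U *m M *m U^t*) *m (U *m M *m U^t*).
    rewrite -!mulmxA (mulmxA (U^t*)) -invmx_unitary //.
    by rewrite mulVmx ?mul1mx // unitarymx_unit.
  by rewrite D mulmx_diag; congr diag_mx; apply/rowP => l; rewrite !mxE.
have XE : X *m X^t* = 1%:M - M *m M by rewrite -MX addrC addKr.
have UX : (U *m X) *m (U *m X)^t* = 1%:M - diag_mx (\row_l d 0 l ^+ 2).
  rewrite adjmxM mulmxA -(mulmxA U) XE mulmxBr mulmxBl mulmx1 D2.
  by congr (_ - _); apply/unitarymxP.
have UXl l : (U *m X *m (U *m X)^t*) l l = 1 - d 0 l ^+ 2.
  by rewrite UX !mxE eqxx !mulr1n.
have d1 l : d 0 l ^+ 2 <= 1.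
  by rewrite -subr_ge0 -UXl; apply: mulmx_adj_diag_ge0.
(* The witness counts the negative eigenvalues, so that [n - 2p] is the sum of the signs. *)
exists #|[pred l | d 0 l < 0]|; first by rewrite -[X in (_ <= X)%N]card_ord max_card.
have -> : \tr (X *m X^t*) = \sum_l (1 - d 0 l ^+ 2).
  rewrite -(mxtrace_unitary_conj _ Uu) mulmxA -mulmxA -adjmxM.
  by apply: eq_bigr => l _; apply: UXl.
rewrite -(mxtrace_unitary_conj M Uu) D mxtrace_diag.
rewrite -[X in X%:R - _]card_ord -sum_sign -sumrB.
apply: le_trans (ler_norm_sum _ _ _) _; apply: ler_sum => l _.
exact: dist_sign_le.
Qed.
End Spectral.

(** * Off-diagonal blocks and rounding on one set *)

Section Rounding.
Variables (R : realType) (N : nat).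
Implicit Types (chi M : 'M[R[i]]_N) (A K : {set 'I_N}).

Definition boundary_weight chi A : R[i] :=
  \sum_(i in A) \sum_(j in ~: A) `|chi i j| ^+ 2.

Lemma boundary_weight_ge0 chi A : 0 <= boundary_weight chi A.
Proof. by do 2!apply: sumr_ge0 => ? _; rewrite exprn_ge0. Qed.

Lemma set_projectionE A :
  set_projection R A = diag_mx (\row_i (i \in A)%:R).
Proof.
by apply/matrixP => i j; rewrite !mxE; case: eqP => [->|]; rewrite ?mulr1n ?mulr0n.
Qed.

Lemma mxtrace_mul_set_projection M A :
  \tr (M *m set_projection R A) = \sum_(i in A) M i i.
Proof.
rewrite [RHS]big_mkcond; apply: eq_bigr => i _.
by rewrite set_projectionE mul_mx_diag !mxE; case: (i \in A); rewrite ?mulr1 ?mulr0.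
Qed.

(** The rows of [U] are eigenvectors, so the diagonalized matrix has signs on its diagonal and
    squares to 1. *)
Lemma quantum_coloring_sqr chi : quantum_coloring chi -> chi *m chi = 1%:M.
Proof.
case=> chiH ev; set U := spectralmx chi.
have Uu : U \in unitmx by apply: spectral_unit.
have D := hermsymmx_diag chiH; rewrite -invmx_unitary ?spectral_unitarymx // in D.
have UD : U *m chi = diag_mx (spectral_diag chi) *m U by rewrite -D mulmxKV.
have d2 l : spectral_diag chi 0 l ^+ 2 = 1.
  case: (ev (spectral_diag chi 0 l)) => [|->|->]; rewrite ?sqrrN ?expr1n //.
  apply/eigenvalueP; exists (row l U).
    by rewrite -row_mul UD row_mul row_diag_mx -scalemxAl -rowE.
  apply/eqP => Ul0; have := congr1 (fun M => row l M 0 l) (mulmxV Uu).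
  by rewrite row_mul Ul0 mul0mx row1 !mxE !eqxx => /eqP; rewrite eq_sym oner_eq0.
have -> : chi = invmx U *m diag_mx (spectral_diag chi) *m U.
  by rewrite -mulmxA -UD mulKmx.
rewrite !mulmxA mulmxK // -(mulmxA (invmx U)) mulmx_diag.
have -> : diag_mx (\row_l (spectral_diag chi 0 l * spectral_diag chi 0 l)) = 1%:M.
  by rewrite -diag_const_mx; congr diag_mx; apply/rowP => l; rewrite !mxE -expr2.
by rewrite mulmx1 mulVmx.
Qed.

Lemma quantum_coloring_adj chi : quantum_coloring chi -> chi^t* = chi.
Proof. by case=> /hermsymmxP. Qed.

(** The block of [chi] linking [A] to its complement, padded with zeros to stay square; its squared
    Frobenius norm is the boundary weight. *)
Definition off_diagonal chi A : 'M[R[i]]_N :=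
  set_projection R A *m chi *m (1%:M - set_projection R A).

Lemma off_diagonal_sqr chi A (P := set_projection R A) : quantum_coloring chi ->
  off_diagonal chi A *m (off_diagonal chi A)^t* = P - P *m chi *m P *m chi *m P.
Proof.
move=> qchi; rewrite /off_diagonal -/P.
have [PP PH] : orthogonal_projection P := set_projectionP R A.
have QH : (1%:M - P)^t* = 1%:M - P.
  by rewrite linearB /= map_mxB PH trmx1 map_mx1.
rewrite !adjmxM QH PH quantum_coloring_adj // !mulmxA.
have QQ : (1%:M - P) *m (1%:M - P) = 1%:M - P.
  by rewrite mulmxBl mul1mx mulmxBr mulmx1 PP subrr subr0.
rewrite -(mulmxA (P *m chi)) QQ mulmxBr mulmx1 !mulmxBl.
by rewrite -(mulmxA P chi chi) quantum_coloring_sqr // mulmx1 PP.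
Qed.

Lemma mxtrace_off_diagonal chi A :
  \tr (off_diagonal chi A *m (off_diagonal chi A)^t*) = boundary_weight chi A.
Proof.
rewrite /boundary_weight [RHS]big_mkcond; apply: eq_bigr => i _.
have XE j : off_diagonal chi A i j = (i \in A)%:R * chi i j * (j \in ~: A)%:R.
  rewrite /off_diagonal mulmxBr mulmx1 set_projectionE mul_diag_mx mul_mx_diag !mxE inE.
  by case: (j \in A); rewrite ?mulr1 ?mulr0 ?subrr ?subr0.
rewrite mxE; case: ifP => iA; last first.
  by apply: big1 => j _; rewrite !XE iA !mul0r.
rewrite [RHS]big_mkcond; apply: eq_bigr => j _.
rewrite [X in _ * X]mxE [X in _ * X^*]mxE XE iA mul1r.
case: ifP => _; last by rewrite mulr0 mul0r.
by rewrite mulr1 normCK.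
Qed.

(** Since [chi^2 = 1], the commutator term is [tr P - tr (chi P chi P)], the squared Frobenius norm
    of the off-diagonal block. *)
Lemma qdisc_exprE chi A : quantum_coloring chi ->
  qdisc_expr chi (set_projection R A) =
    (\sum_(i in A) chi i i) ^+ 2 + boundary_weight chi A.
Proof.
move=> qchi; rewrite /qdisc_expr mxtrace_mul_set_projection; congr (_ + _).
have [PP _] := set_projectionP R A.
rewrite -mxtrace_off_diagonal off_diagonal_sqr // /mxcomm mulmxBr mulmxBl !linearB /=.
congr (_ - _); first by rewrite mulmxA quantum_coloring_sqr // mul1mx PP.
by rewrite mxtrace_mulC [in RHS]mxtrace_mulC !mulmxA PP.
Qed.

Lemma exists_subset_card (T : finType) (K : {set T}) p : (p <= #|K|)%N ->
  exists2 B : {set T}, B \subset K & #|B| = p.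
Proof.
move=> pK; exists [set x in take p (enum K)].
  by apply/subsetP => x; rewrite inE => /mem_take; rewrite mem_enum.
rewrite cardsE; move/card_uniqP: (take_uniq p (enum_uniq K)) => ->.
by rewrite size_takel // -cardE.
Qed.

Lemma exists_coloring_sum K p : (p <= #|K|)%N ->
  exists c : coloring N, coloring_sum c K = #|K|%:Z - p.*2%:Z.
Proof.
case/exists_subset_card => B BK <-; exists [ffun i => i \in B].
rewrite /coloring_sum.
under eq_bigr => i _ do rewrite ffunE signrE -muln2 natrM.
rewrite sumrB sumr_const -mulr_suml; congr (_ - _); first by rewrite natz.
rewrite (big_setID B) /= (setIidPr BK) [X in _ + X]big1 => [|i /setDP[_ /negPf ->]] //.
rewrite addr0 (eq_bigr (fun=> 1)) => [|i ->] //.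
by rewrite sumr_const natz -PoszM muln2.
Qed.

(* [B := P chi P + (1 - P)] satisfies [B^2 + X X^* = 1], where [X] is the
   off-diagonal block of [chi], so its trace is close to a sum of signs. *)
Lemma quantum_coloring_rounding chi K :
  quantum_coloring chi -> boundary_weight chi K < 1 ->
  exists c : coloring N,
    `|\sum_(i in K) chi i i - (coloring_sum c K)%:~R| <= boundary_weight chi K.
Proof.
move=> qchi lt1; set P := set_projection R K.
have [PP PH] : orthogonal_projection P := set_projectionP R K.
pose B := P *m chi *m P + (1%:M - P).
have BH : B \is hermsymmx.
  apply/hermsymmxP; rewrite /B linearD linearB /= map_mxD map_mxB.
  by rewrite !adjmxM PH quantum_coloring_adj // trmx1 map_mx1 mulmxA.
have BX := off_diagonal_sqr K qchi; rewrite -/P in BX.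
have trX := mxtrace_off_diagonal chi K; rewrite -/P in trX.
set X := off_diagonal chi K in BX trX.
have BB : B *m B + X *m X^t* = 1%:M.
  have TP : P *m chi *m P *m P = P *m chi *m P by rewrite -mulmxA PP.
  rewrite BX /B mulmxDl !mulmxDr !(mulmxBl, mulmxBr) !mulmxA !TP !mul1mx !mulmx1.
  rewrite !mulmxN TP !PP opprK addNr addr0 subrr add0r addr0.
  by rewrite addrC addrA subrK addrC subrK.
have [p _] := mxtrace_near_sign BH BB; rewrite trX.
(* The summand [1 - P] contributes [N - #|K|], so comparing with [N - 2p] amounts to comparing the
   sum over [K] with [#|K| - 2p]. *)
have -> : \tr B = \sum_(i in K) chi i i + (N%:R - #|K|%:R).
  rewrite /B linearD linearB /= mxtrace1; congr (_ + (_ - _)).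
    by rewrite mxtrace_mulC mulmxA PP mxtrace_mulC mxtrace_mul_set_projection.
  rewrite -[P]mul1mx mxtrace_mul_set_projection -sumr_const.
  by apply: eq_bigr => i _; rewrite mxE eqxx.
set t := \sum_(i in K) _; move=> tp.
have {}tp : `|t - (#|K|%:Z - p.*2%:Z)%:~R| <= boundary_weight chi K.
  apply: le_trans tp; rewrite intrB -!pmulrn le_eqVlt; apply/orP; left.
  by apply/eqP; congr `|_|; ring.
(* The rows of [chi] are unit vectors, so its diagonal entries have modulus at most 1. *)
have tK : `|t| <= #|K|%:R.
  rewrite -sumr_const; apply: le_trans (ler_norm_sum _ _ _) _; apply: ler_sum => i _.
  rewrite -(@expr_le1 _ 2) // -[leRHS](_ : (1%:M : 'M[R[i]]_N) i i = 1); last first.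
    by rewrite mxE eqxx.
  rewrite -(quantum_coloring_sqr qchi) -{3}(quantum_coloring_adj qchi) mxE.
  rewrite (bigD1 i) //= !mxE -normCK lerDl sumr_ge0 // => j _.
  by rewrite !mxE -normCK exprn_ge0.
(* [#|K| - 2p] is an integer at distance less than 1 from [t], hence of absolute value at most
   [#|K|]. *)
have pK : (p <= #|K|)%N.
  have : `|(#|K|%:Z - p.*2%:Z)%:~R| < (#|K|%:Z + 1)%:~R :> R[i].
    rewrite [ltRHS]intrD -pmulrn -[X in `|X|](subKr t).
    apply: le_lt_trans (ler_normB _ _) _.
    exact: ler_ltD tK (le_lt_trans tp lt1).
  rewrite -intr_norm ltr_int; lia.
have [c cK] := exists_coloring_sum pK.
by exists c; rewrite cK.
Qed.

End Rounding.

(** * Atoms of the generated Boolean algebra, and gluing *)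

Section Gluing.
Variables (R : realType) (N : nat) (F : {set {set 'I_N}}).
Implicit Types (chi : 'M[R[i]]_N) (A : {set 'I_N}).

Lemma boundary_weightC chi A :
  chi^t* = chi -> boundary_weight chi (~: A) = boundary_weight chi A.
Proof.
move=> chiH; rewrite /boundary_weight setCK exchange_big /=.
apply: eq_bigr => i _; apply: eq_bigr => j _.
by rewrite -{1}chiH !mxE norm_conjC.
Qed.

(** A pair with [i] inside the intersection and [j] outside also crosses the boundary of at least
    one [G A]. *)
Lemma boundary_weight_bigcap chi (G : {set 'I_N} -> {set 'I_N}) :
  boundary_weight chi (\bigcap_(A in F) G A) <=
    \sum_(A in F) boundary_weight chi (G A).
Proof.
pose w (B : {set 'I_N}) i j : R[i] :=
  if (i \in B) && (j \notin B) then `|chi i j| ^+ 2 else 0.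
have w_ge0 B i j : 0 <= w B i j by rewrite /w; case: ifP; rewrite ?exprn_ge0.
have wE B : boundary_weight chi B = \sum_i \sum_j w B i j.
  rewrite /boundary_weight big_mkcond; apply: eq_bigr => i _.
  rewrite /w; case: (i \in B); last by rewrite big1.
  by rewrite big_mkcond; apply: eq_bigr => j _; rewrite inE.
rewrite wE (eq_bigr _ (fun A _ => wE (G A))) [X in _ <= X]exchange_big /=.
apply: ler_sum => i _; rewrite [X in _ <= X]exchange_big /=; apply: ler_sum => j _.
rewrite {1}/w; case: ifP => [/andP[/bigcapP iG jG]|_]; last exact: sumr_ge0.
have /exists_inP[A AF jA] : [exists A in F, j \notin G A].
  by rewrite -negb_forall_in; apply: contra jG => /forall_inP ?; apply/bigcapP.
by rewrite (bigD1 A) //= {1}/w iG // jA lerDl sumr_ge0.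
Qed.

(** The atom through [i] of the Boolean algebra generated by [F]. Indexing by points leaves out
    empty atoms; one atom may have several indices. *)
Definition atom i : {set 'I_N} := \bigcap_(A in F) if i \in A then A else ~: A.

Lemma atomP i j : reflect {in F, forall A, (j \in A) = (i \in A)} (j \in atom i).
Proof.
apply: (iffP bigcapP) => h A /h; case: ifP => _; rewrite ?inE //.
by move=> /negPf.
by move=> ->.
Qed.

Lemma eq_atom i j : (atom i == atom j) = (i \in atom j).
Proof.
apply/eqP/idP => [<-|/atomP ij]; first exact/atomP.
by apply/setP => k; apply/atomP/atomP => h A AF; rewrite h ?ij.
Qed.

Lemma boundary_weight_atom chi i : chi^t* = chi ->
  boundary_weight chi (atom i) <= \sum_(A in F) boundary_weight chi A.
Proof.
move=> chiH; apply: le_trans (boundary_weight_bigcap _ _) _.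
by apply: ler_sum => A _; case: ifP; rewrite ?boundary_weightC.
Qed.

(** The constant is an error budget: one [eps] for the quantum sum over [A], and [#|F| * eps] for
    rounding on each of at most [N] atoms. An integer below this budget in absolute value is 0. *)
Lemma coloring_of_quantum_coloring chi (eps : R[i]) :
  quantum_coloring chi -> 0 < eps -> (1 + N * #|F|)%:R * eps <= 1 ->
  {in F, forall A, `|\sum_(i in A) chi i i| < eps} ->
  {in F, forall A, boundary_weight chi A <= eps} ->
  exists c : coloring N, {in F, forall A, coloring_sum c A = 0}.
Proof.
move=> qchi eps0 eps1 small_sum small_bw.
have chiH := quantum_coloring_adj qchi.
have bw_atom i : boundary_weight chi (atom i) <= #|F|%:R * eps.
  apply: le_trans (boundary_weight_atom _ chiH) _.
  by rewrite mulr_natl -sumr_const; apply: ler_sum.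
have bw_lt1 i : boundary_weight chi (atom i) < 1.
  apply: le_lt_trans (bw_atom i) (lt_le_trans _ eps1).
  (* The index [i] witnesses [0 < N], hence [#|F| <= N * #|F|]. *)
  rewrite ltr_pM2r // ltr_nat add1n ltnS leq_pmull //.
  exact: leq_ltn_trans (ltn_ord i).
(* Keeping the bound as a premise under the existential lets [f] be defined on all sets, not only on
   atoms. *)
have /fin_all_exists[f fP] K : exists c : coloring N, boundary_weight chi K < 1 ->
    `|\sum_(i in K) chi i i - (coloring_sum c K)%:~R| <= boundary_weight chi K.
  have [lt1|_] := boolP (boundary_weight chi K < 1); last by exists [ffun=> false].
  by have [c cP] := quantum_coloring_rounding qchi lt1; exists c.
(* Each point takes its color from the coloring chosen for its atom. *)
exists [ffun i => f (atom i) i] => A AF; set c := finfun _.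
have cK i : coloring_sum c (atom i) = coloring_sum (f (atom i)) (atom i).
  by apply: eq_bigr => j; rewrite -eq_atom ffunE => /eqP ->.
suff : `|(coloring_sum c A)%:~R| < 1 :> R[i].
  rewrite -intr_norm (ltr_int _ _ 1); lia.
rewrite -[X in `|X|](subKr (\sum_(i in A) chi i i)).
apply: le_lt_trans (ler_normB _ _) _; apply: lt_le_trans eps1.
rewrite natrD mulrDl mul1r natrM -mulrA; apply: ltr_leD; first exact: small_sum.
have -> : \sum_(i in A) chi i i - (coloring_sum c A)%:~R =
    \sum_(i in A) (chi i i - ((-1) ^+ c i)%:~R).
  by rewrite sumrB rmorph_sum.
(* [A] is a disjoint union of atoms, so the rounding errors add up atom by atom. *)
rewrite (partition_big_imset atom) /=.
apply: (@le_trans _ _ (\sum_(K in atom @: A) #|F|%:R * eps)); last first.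
  rewrite sumr_const -[leLHS]mulr_natl ler_wpM2r ?mulr_ge0 ?ler0n ?(ltW eps0) // ler_nat.
  by rewrite (leq_trans (leq_imset_card _ _)) // -[leqRHS]card_ord max_card.
apply: le_trans (ler_norm_sum _ _ _) _; apply: ler_sum => _ /imsetP[k kA ->].
apply: le_trans (bw_atom k); rewrite (eq_bigl (mem (atom k))) => [|i]; last first.
  rewrite eq_atom inE /=; have [/atomP ik|] := boolP (i \in atom k).
    by rewrite ik // kA.
  by rewrite andbF.
by rewrite sumrB -rmorph_sum /= -/(coloring_sum c _) cK fP.
Qed.

End Gluing.

(** * Vanishing of the combinatorial discrepancy *)

Section Disc.
Variables (N : nat) (F : {set {set 'I_N}}).

Lemma coloring_disc_eq0 (c : coloring N) :
  coloring_disc F c = 0%N <-> {in F, forall A, coloring_sum c A = 0}.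
Proof.
split=> [c0 A AF|c0].
  apply/eqP; rewrite -absz_eq0 -leqn0 -c0 /coloring_disc.
  exact: leq_bigmax_cond.
by apply/eqP; rewrite -leqn0; apply/bigmax_leqP => A /c0 ->.
Qed.

Lemma Disc_eq0 :
  Disc F = 0%N <-> exists c : coloring N, {in F, forall A, coloring_sum c A = 0}.
Proof.
split=> [D0|[c /coloring_disc_eq0 c0]].
  by eexists; apply/coloring_disc_eq0; apply: D0.
by apply/eqP; rewrite -leqn0 -c0 /Disc; case: arg_minnP => // m _; apply.
Qed.

End Disc.

(** * Diagonal quantum colorings and bounds at single projections *)

Section QDisc.
Variables (R : realType) (N : nat) (F : {set {set 'I_N}}).
Implicit Types (chi : 'M[R[i]]_N).

Definition coloring_mx (c : coloring N) : 'M[R[i]]_N :=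
  diag_mx (\row_i (-1) ^+ c i).

Lemma coloring_mx_quantum c : quantum_coloring (coloring_mx c).
Proof.
split.
  apply/hermsymmxP; rewrite tr_diag_mx map_diag_mx; congr diag_mx.
  by apply/rowP => i; rewrite !mxE rmorph_sign.
move=> a /eigenvalueP[v va /eqP v0].
have [i vi] : exists i, v 0 i != 0.
  apply/existsP; apply: contra_notT v0; rewrite negb_exists => /forallP v0.
  by apply/rowP => i; rewrite mxE; apply/eqP; have := v0 i; rewrite negbK.
have := congr1 (fun u : 'rV_N => u 0 i) va.
rewrite mul_mx_diag !mxE mulrC => /(mulIf vi) <-.
by case: (c i); [right|left].
Qed.

Lemma qdisc_expr_coloring_mx c A :
  qdisc_expr (coloring_mx c) (set_projection R A) = (coloring_sum c A)%:~R ^+ 2.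
Proof.
rewrite qdisc_exprE; last exact: coloring_mx_quantum.
rewrite [boundary_weight _ _]big1 ?addr0 => [|i iA].
  rewrite rmorph_sum; congr (_ ^+ 2); apply: eq_bigr => i _.
  by rewrite !mxE eqxx mulr1n rmorph_sign.
apply: big1 => j; rewrite inE !mxE; case: eqP => [<-|_ _]; first by rewrite iA.
by rewrite normr0 expr0n.
Qed.

Lemma quantum_coloring_disc_ge0 (sys : projection_system R N) chi :
  0 <= quantum_coloring_disc sys chi.
Proof. exact: bigmax_ge_id. Qed.

Lemma quantum_coloring_disc_coloring_mx c :
  {in F, forall A, coloring_sum c A = 0} ->
  quantum_coloring_disc (set_projection_system R F) (coloring_mx c) = 0.
Proof.
move=> c0; apply/le_anti; rewrite quantum_coloring_disc_ge0 andbT.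
rewrite /quantum_coloring_disc big_seq; apply: bigmax_le => // P /imfsetP[A AF ->].
by rewrite qdisc_expr_coloring_mx c0 // expr0n /= sqrtr0.
Qed.

(** The bracket is real and nonnegative, so it equals its real part, and squaring undoes the
    root. *)
Lemma quantum_coloring_disc_lt chi (e : R) A :
  quantum_coloring chi -> A \in F ->
  quantum_coloring_disc (set_projection_system R F) chi < e ->
  qdisc_expr chi (set_projection R A) < (e ^+ 2)%:C%C.
Proof.
move=> qchi AF lte.
have := qdisc_expr_ge0 qchi (set_projectionP R A).
set z := qdisc_expr _ _ => z0.
have zE : z = (complex.Re z)%:C%C by rewrite RRe_real // ger0_real.
have e0 : 0 < e := le_lt_trans (quantum_coloring_disc_ge0 _ _) lte.
rewrite zE ltcR; rewrite zE ler0c in z0.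
rewrite -(sqr_sqrtr z0) ltr_pXn2r ?nnegrE ?sqrtr_ge0 ?ltW //.
apply: le_lt_trans lte; rewrite /quantum_coloring_disc.
apply: (le_bigmax_seq 0 (set_projection R A) xpredT
  (fun P => Num.sqrt (complex.Re (qdisc_expr chi P)))) => //.
exact: in_imfset.
Qed.

End QDisc.

Theorem theorem5 (R : realType) (N : nat) (F : {set {set 'I_N}}) :
  (0 < N)%N -> F != set0 ->
  QDisc (set_projection_system R F) = 0 <-> Disc F = 0%N.
Proof.
move=> _ _; rewrite Disc_eq0 /QDisc.
set E := (X in inf X).
have lbE : classical_sets.lbound E 0.
  by move=> _ [chi _ <-]; apply: quantum_coloring_disc_ge0.
have infE : classical_sets.has_inf E.
  split; last by exists 0.
  by eexists; exists (coloring_mx R [ffun=> false]); first exact: coloring_mx_quantum.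
split=> [E0|[c c0]]; last first.
  apply/le_anti/andP; split; last by apply: lb_le_inf => //; case: infE.
  rewrite -(quantum_coloring_disc_coloring_mx R c0); apply: ge_inf; first by exists 0.
  by exists (coloring_mx R c) => //; apply: coloring_mx_quantum.
(* This [e] spends the error budget exactly, and [e <= 1] gives [e^2 <= e] for the boundary
   weights. *)
pose e : R := (1 + N * #|F|)%:R^-1.
have e0 : 0 < e by rewrite invr_gt0 ltr0n.
have e1 : e <= 1 by rewrite invf_le1 ?ltr0n // ler1n.
have [_ [chi qchi <-]] := inf_adherent e0 infE; rewrite E0 add0r => lte.
have ltA A : A \in F ->
    (\sum_(i in A) chi i i) ^+ 2 + boundary_weight chi A < (e ^+ 2)%:C%C.
  by move=> AF; rewrite -qdisc_exprE //; apply: quantum_coloring_disc_lt lte.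
have sr A : \sum_(i in A) chi i i \is Num.real.
  apply: rpred_sum => i _; apply/CrealP.
  by rewrite -{2}(quantum_coloring_adj qchi) !mxE.
apply: (@coloring_of_quantum_coloring R N F chi e%:C%C) => // [||A AF|A AF].
- by rewrite ltcR.
- by rewrite -(rmorph_nat (real_complex R)) -rmorphM /= mulfV // pnatr_eq0.
(* Both summands in [ltA] are nonnegative, so each alone is below [e^2]. *)
- rewrite -(@ltr_pXn2r _ 2) ?normr_nneg ?nnegrE ?ler0c ?(ltW e0) //.
  rewrite real_normK // -rmorphXn /=.
  by apply: le_lt_trans (ltA A AF); rewrite lerDl boundary_weight_ge0.
- apply: (@le_trans _ _ (e ^+ 2)%:C%C); last first.
    by rewrite lecR expr2 ler_piMr // ltW.
  by apply: ltW; apply: le_lt_trans (ltA A AF); rewrite lerDr real_exprn_even_ge0.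
Qed.
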